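(* Let $\{K_j\}_{j=1}^m$ be a clique cover of a finite graph on the node set $[n]$, let $\mathbf{c}\in\mathbb{R}^{n+m}$ be a cost vector with $c_{n+j}=0$ for $j\in[m]$, and let $T>0$. Consider the dual smoothed clique cover relaxation problem $$\min_{\boldsymbol\lambda\in\mathbb{R}^m}\ \Bigl[D^T(\boldsymbol\lambda):=\sum_{j=1}^m\lambda_j+\max_{\mathbf{x}\in[0,1]^{n+m}}\bigl(\langle\mathbf{c}^{\boldsymbol\lambda},\mathbf{x}\rangle+T\,\mathcal{H}(\mathbf{x})\bigr)\Bigr].$$ Then the Bregman method in log domain (see context), run for infinitely many iterations from an arbitrary initial $\boldsymbol\lambda\in\mathbb{R}^m$, converges to the optimum of this problem (its iterates $\boldsymbol\lambda$ converge to an optimal solution), and it implements the coordinate minimization principle, i.e., each update of $\lambda_j$ minimizes $D^T$ with respect to the coordinate $\lambda_j$ with all other coordinates fixed. In particular, $D^T$ is convex and differentiable, and right after processing clique $j\in[m]$ (updating $\lambda_j$) it holds that $\frac{\partial D^T}{\partial\lambda_j}(\boldsymbol\lambda)=0$.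
   Context: Notation: $[k]=\{1,\dots,k\}$. Let $\mathcal{G}=(\mathcal{V},\mathcal{E})$ be a finite undirected graph with $\mathcal{V}=[n]$. A clique cover is a family of subsets $K_j\subseteq\mathcal{V}$, $j\in[m]$, each inducing a complete subgraph of $\mathcal{G}$, that covers all edges and nodes: $\mathcal{E}=\bigcup_{j}\{\{i,i'\}\mid i,i'\in K_j,\ i\neq i'\}$ and $\mathcal{V}=\bigcup_j K_j$. For each clique introduce a slack index $n+j$ with cost $c_{n+j}=0$ and put $\bar K_j=K_j\cup\{n+j\}$. For $i\in[n+m]$ let $J_i=\{j\in[m]\mid i\in\bar K_j\}$. For $\boldsymbol\lambda\in\mathbb{R}^m$ the reduced costs are $c^{\boldsymbol\lambda}_i=c_i-\sum_{j\in J_i}\lambda_j$, $i\in[n+m]$. The (shifted) entropy is $\mathcal{H}(\mathbf{x})=-\sum_{i=1}^{n+m}(x_i\log x_i-x_i)$ with $0\log0=0$. Bregman method in log domain. Input: $\boldsymbol\lambda\in\mathbb{R}^m$, $T>0$. Repeat outer iterations; each outer iteration loops over the cliques $j=1,\dots,m$ and for each $j$ picks $i^*\in\arg\max_{i\in\bar K_j}c^{\boldsymbol\lambda}_i$ and updates $$\lambda_j:=\lambda_j+c^{\boldsymbol\lambda}_{i^*}+T\log\sum_{i\in\bar K_j}\exp\frac{c^{\boldsymbol\lambda}_i-c^{\boldsymbol\lambda}_{i^*}}{T},$$ where the reduced costs on the right-hand side are those of the current $\boldsymbol\lambda$ before the update. *)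

(* Defs.v *)
From HB Require Import structures.
From mathcomp Require Import all_boot all_order all_algebra.
From mathcomp Require Import all_classical all_reals all_analysis.
From mathcomp Require Import ring lra.

Set Implicit Arguments.
Unset Strict Implicit.
Unset Printing Implicit Defensive.

Import Order.TTheory GRing.Theory Num.Theory.
Import numFieldNormedType.Exports.

Local Open Scope classical_set_scope.
Local Open Scope ring_scope.

Section CliqueCover.
Variables n m : nat.

Definition clique (e : rel 'I_n) (A : {set 'I_n}) : Prop :=
  forall i i', i \in A -> i' \in A -> i != i' -> e i i'.

Definition clique_cover (e : rel 'I_n) (K : 'I_m -> {set 'I_n}) : Prop :=
  [/\ forall j, clique e (K j),
      forall i i', e i i' <-> exists j, [/\ i \in K j, i' \in K j & i != i']
    & forall i, exists j, i \in K j].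

(* Nodes are embedded in the n + m indices by lshift; the slack index of
   clique j is rshift n j. *)
Definition ext_clique (K : 'I_m -> {set 'I_n}) (j : 'I_m) : {set 'I_(n + m)} :=
  (rshift n j |: [set lshift m i | i in K j])%SET.

Definition cliques_of (K : 'I_m -> {set 'I_n}) (i : 'I_(n + m)) : {set 'I_m} :=
  [set j | i \in ext_clique K j]%SET.

End CliqueCover.

Section DualProblem.
Variables (R : realType) (n m : nat) (K : 'I_m -> {set 'I_n}).
Variables (c : 'rV[R]_(n + m)) (T : R).

Definition reduced_cost (lam : 'rV[R]_m) : 'rV[R]_(n + m) :=
  \row_i (c 0 i - \sum_(j in cliques_of K i) lam 0 j).

(* ln 0 = 0 in the library, so the convention 0 log 0 = 0 holds. *)
Definition entropy (x : 'rV[R]_(n + m)) : R :=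
  - \sum_i (x 0 i * ln (x 0 i) - x 0 i).

Definition unit_cube : set 'rV[R]_(n + m) :=
  [set x | forall i, 0 <= x 0 i <= 1].

Definition smoothed_objective (lam : 'rV[R]_m) (x : 'rV[R]_(n + m)) : R :=
  \sum_i reduced_cost lam 0 i * x 0 i + T * entropy x.

(* The supremum is a maximum: see smoothed_dual_max. *)
Definition smoothed_dual (lam : 'rV[R]_m) : R :=
  \sum_j lam 0 j + sup (smoothed_objective lam @` unit_cube).

Definition set_coord (lam : 'rV[R]_m) (j : 'I_m) (v : R) : 'rV[R]_m :=
  \row_k (if k == j then v else lam 0 k).

(* A relation, because the maximizing index istar may be picked freely. *)
Definition bregman_step (j : 'I_m) (lam lam' : 'rV[R]_m) : Prop :=
  let cl := reduced_cost lam in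
  exists istar : 'I_(n + m),
    [/\ istar \in ext_clique K j,
        forall i, i \in ext_clique K j -> cl 0 i <= cl 0 istar
      & lam' = set_coord lam j
          (lam 0 j + cl 0 istar
           + T * ln (\sum_(i in ext_clique K j)
                        expR ((cl 0 i - cl 0 istar) / T)))].

(* lam t k is the vector in outer iteration t after its first k cliques have
   been processed; only the values with k <= m are meaningful. *)
Definition bregman_run (lam0 : 'rV[R]_m) (lam : nat -> nat -> 'rV[R]_m) : Prop :=
  [/\ lam 0 0 = lam0,
      forall t (j : 'I_m), bregman_step j (lam t j) (lam t j.+1)
    & forall t, lam t.+1 0 = lam t m].

Let xlogx_max (a : R) : 0 < T -> exists2 y : R, 0 <= y <= 1 &
  forall x, 0 <= x <= 1 ->
    a * x - T * (x * ln x - x) <= a * y - T * (y * ln y - y).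
Proof.
move=> T0; pose b := Num.min a 0; exists (expR (b / T)).
  rewrite expR_ge0 -[leRHS]expR0 ler_expR /= ler_pdivrMr // mul0r.
  by rewrite /b ge_min lexx orbT.
move=> x /andP[x0 x1]; set y := expR _.
have y0 : 0 < y by exact: expR_gt0.
have lny : T * ln y = b by rewrite expRK mulrC divfK // gt_eqF.
have le1 : T * (x * ln y) - T * (x * ln x) <= T * (y - x).
  rewrite -mulrBr ler_pM2l //.
  move: x0; rewrite le_eqVlt => /predU1P[<-|x0].
    by rewrite !mul0r !subr0 ltW.
  rewrite -mulrBr -ln_div ?posrE //.
  have le_ln : ln (y / x) <= y / x - 1.
    rewrite -{1}[y / x](subrKC 1); apply: le_ln1Dx.
    by rewrite ltrBDl addrN divr_gt0.
  have -> : y - x = x * (y / x - 1) by field; rewrite gt_eqF.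
  by rewrite ler_pM2l.
have le2 : (a - b) * (x - y) <= 0.
  rewrite /b; case: (lerP a 0) => a0; first by rewrite subrr mul0r.
  rewrite subr0; have -> : y = 1.
    by rewrite /y /b min_r ?ltW// mul0r expR0.
  by apply: mulr_ge0_le0; [exact: ltW | rewrite subr_le0].
have e1 : T * (x * ln y) = b * x by rewrite -lny; ring.
have e2 : T * (y * ln y) = b * y by rewrite -lny; ring.
rewrite e1 in le1; rewrite !mulrBr e2; rewrite mulrBr in le1.
by move: le2; rewrite mulrBr !mulrBl; lra.
Qed.

Let smoothed_objectiveE lam x : smoothed_objective lam x =
  \sum_i (reduced_cost lam 0 i * x 0 i - T * (x 0 i * ln (x 0 i) - x 0 i)).
Proof. by rewrite sumrB -mulr_sumr -mulrN. Qed.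

Lemma smoothed_dual_max (lam : 'rV[R]_m) : 0 < T ->
  exists2 x, unit_cube x &
    (forall y, unit_cube y ->
       smoothed_objective lam y <= smoothed_objective lam x)
    /\ smoothed_dual lam = \sum_j lam 0 j + smoothed_objective lam x.
Proof.
move=> T0.
have /choice[f fP] : forall i, exists y : R, 0 <= y <= 1 /\
    forall x, 0 <= x <= 1 -> reduced_cost lam 0 i * x - T * (x * ln x - x) <=
                             reduced_cost lam 0 i * y - T * (y * ln y - y).
  by move=> i; have [y ? ?] := xlogx_max (reduced_cost lam 0 i) T0; exists y.
pose x : 'rV[R]_(n + m) := \row_i f i.
have cx : unit_cube x by move=> i; rewrite mxE; case: (fP i).
have xmax y : unit_cube y ->
    smoothed_objective lam y <= smoothed_objective lam x.
  move=> cy; rewrite !smoothed_objectiveE; apply: ler_sum => i _.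
  by rewrite [x 0 i]mxE; apply: (fP i).2; exact: cy.
exists x => //; split=> //; congr (_ + _).
apply/eqP; rewrite eq_le; apply/andP; split.
  by apply: ge_sup; [exists (smoothed_objective lam x), x | move=> _ [y cy <-]; exact: xmax].
apply: ub_le_sup; last by exists x.
by exists (smoothed_objective lam x) => _ [y cy <-]; exact: xmax.
Qed.

Let bregman_step_exists j lam : exists lam', bregman_step j lam lam'.
Proof.
have jK : rshift n j \in ext_clique K j by rewrite !inE eqxx.
have [i iK imax] := @arg_maxP _ _ _ _ (mem (ext_clique K j))
  (fun i => reduced_cost lam 0 i) jK.
by eexists; exists i; split=> //; exact: imax.
Qed.

Lemma bregman_run_exists (lam0 : 'rV[R]_m) : exists lam, bregman_run lam0 lam.
Proof.
have /choice[f fP] : forall p : 'I_m * 'rV[R]_m,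
  exists lam', bregman_step p.1 p.2 lam'.
  by move=> p; exact: bregman_step_exists.
pose inner := fix inner (l : 'rV[R]_m) (k : nat) := if k is k'.+1 then
  (if insub k' is Some j then f (j, inner l k') else l) else l.
pose start := fix start (t : nat) :=
  if t is t'.+1 then inner (start t') m else lam0.
exists (fun t => inner (start t)); split=> // t j /=.
by rewrite valK; exact: (fP (j, _)).
Qed.

End DualProblem.

(* Main.v *)
Require Import Defs.
From HB Require Import structures.
From mathcomp Require Import all_boot all_order all_algebra.
From mathcomp Require Import all_classical all_reals all_analysis.
From mathcomp Require Import ring lra.

(**
  The maximum over the box splits into one-dimensional maxima: it is the sum
  of f(c^lam_i), where f(a) = T exp(a/T) for a <= 0 and f(a) = a + T for a > 0.
  The function f is convex and C^1, so D is convex and differentiable, and it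
  lies above its tangent planes.  Let S_j(lam) be the sum of exp(c^lam_i/T)
  over the j-th extended clique.  A step adds T ln S_j to lam_j, after which
  S_j = 1; then all reduced costs in that clique are nonpositive, hence the
  j-th partial derivative of D vanishes.

  Let E(lam) = sum_j lam_j + T sum_i exp(c^lam_i/T).  A step decreases E by
  T (S_j - 1 - ln S_j) >= T (sqrt(S_j) - 1)^2.  The slack indices contribute
  lam_j + T exp(-lam_j/T), which makes E bounded below with |lam_j| <= E(lam).
  So the iterates are bounded and the step lengths tend to 0, and every cluster
  point satisfies S_j = 1 for all j.  Such a point is unique because E is
  strictly convex, and it minimizes D because the gradient of D vanishes there.
*)

Import Order.TTheory GRing.Theory Num.Theory.
Import numFieldNormedType.Exports.

Local Open Scope classical_set_scope.
Local Open Scope ring_scope.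

Set Implicit Arguments.
Unset Strict Implicit.
Unset Printing Implicit Defensive.

(** * Limits of real functions and inequalities for exp *)

Lemma cvg_bigsum (R : realType) (X I : Type) (F : set_system X) {FF : Filter F}
    (r : seq I) (P : pred I) (f : I -> X -> R) (l : I -> R) :
  (forall i, P i -> f i @ F --> l i) ->
  (fun x => \sum_(i <- r | P i) f i x) @ F --> \sum_(i <- r | P i) l i.
Proof.
move=> fl.
have -> : (fun x => \sum_(i <- r | P i) f i x) = \sum_(i <- r | P i) f i.
  by apply/funext => x; rewrite fct_sumE.
apply: (big_ind2 (fun (g : X -> R) (b : R) => g @ F --> b)) => //.
- exact: cvg_cst.
- by move=> g a h b ga hb; exact: cvgD.
Qed.

Lemma cvg_sqr0 (R : realType) (X : Type) (F : set_system X) {FF : Filter F}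
    (f : X -> R) : (fun x => f x ^+ 2) @ F --> (0 : R) -> f @ F --> (0 : R).
Proof.
move=> f20; apply/norm_cvg0P.
have -> : (fun x => `|f x|) = Num.sqrt \o (fun x => f x ^+ 2).
  by apply/funext => x; rewrite /= sqrtr_sqr.
rewrite -[X in _ --> X](@sqrtr0 R).
by apply: continuous_cvg => //; exact: sqrt_continuous.
Qed.

(** Multiply [x <= expR (x - 1)] by [2 <= expR 1]. *)
Lemma expR_ge2x (R : realType) (x : R) : 0 <= x -> 2 * x <= expR x.
Proof.
move=> x0; have := expR_ge1Dx (1 : R); have := expR_ge1Dx (x - 1).
have -> : expR x = expR (x - 1) * expR 1 by rewrite -expRD subrK.
by nra.
Qed.

(** With [y = expR (d / 2)], the right side minus the left is [2 * (y - 1 - d / 2)]. For [d] the log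
    of a clique mass, a small decrease of the potential thus forces a small step. *)
Lemma sqr_expR_half_le (R : realType) (d : R) :
  (expR (d / 2) - 1) ^+ 2 <= expR d - 1 - d.
Proof.
have := expR_ge1Dx (d / 2).
have -> : expR d = expR (d / 2) ^+ 2.
  by rewrite expr2 -expRD; congr expR; field.
by nra.
Qed.

(** * The inner maximum *)

Section SmoothedRamp.
Variables (R : realType) (T : R).
Hypothesis T_gt0 : 0 < T.

(* The maximizer, and below it the maximum, of a x - T (x ln x - x) over
   x in [0, 1]. *)
Definition ramp_slope (a : R) : R := expR (Num.min a 0 / T).

Definition smoothed_ramp (a : R) : R := T * ramp_slope a + Num.max a 0.

Lemma ramp_slopeE a : a <= 0 -> ramp_slope a = expR (a / T).
Proof. by move=> a0; rewrite /ramp_slope min_l. Qed.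

Lemma ramp_slope01 a : 0 <= ramp_slope a <= 1.
Proof.
rewrite expR_ge0 -[leRHS]expR0 ler_expR /= ler_pdivrMr // mul0r.
by rewrite ge_min lexx orbT.
Qed.

Lemma expR_tangent (a b : R) :
  T * expR (a / T) + expR (a / T) * (b - a) <= T * expR (b / T).
Proof.
have -> : b / T = a / T + (b - a) / T by field; rewrite gt_eqF.
have := expR_ge1Dx ((b - a) / T); rewrite expRD mulrCA.
rewrite -(ler_pM2l T_gt0) -(ler_pM2l (expR_gt0 (a / T))).
have -> : T * (1 + (b - a) / T) = T + (b - a) by field; rewrite gt_eqF.
by rewrite mulrDr [expR _ * T]mulrC.
Qed.

(** Split each argument into its [min] and [max] with 0. The [min] parts obey the tangent inequality
    of exp; for the [max] parts the slope is 1 if [a > 0], and otherwise at most 1 against an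
    increment that is nonnegative. *)
Lemma smoothed_ramp_tangent a b :
  smoothed_ramp a + ramp_slope a * (b - a) <= smoothed_ramp b.
Proof.
rewrite /smoothed_ramp; have /andP[u0 u1] := ramp_slope01 a.
have ub := expR_tangent (Num.min a 0) (Num.min b 0).
rewrite -!/(ramp_slope _) in ub.
suff : ramp_slope a * (Num.max b 0 - Num.max a 0) <= Num.max b 0 - Num.max a 0.
  have e (x : R) : x = Num.min x 0 + Num.max x 0.
    by case: (lerP x 0) => _; rewrite ?addr0 ?add0r.
  have -> : b - a = (Num.min b 0 - Num.min a 0) + (Num.max b 0 - Num.max a 0).
    by rewrite {1}(e a) {1}(e b); ring.
  by rewrite mulrDr; lra.
have [a0|a0] := lerP a 0; last first.
  by rewrite /ramp_slope (min_r (ltW a0)) mul0r expR0 mul1r.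
by rewrite subr0 ler_piMl // le_max lexx orbT.
Qed.

Lemma smoothed_ramp_ge0 a : 0 <= smoothed_ramp a.
Proof.
apply: addr_ge0; last by rewrite le_max lexx orbT.
by apply: mulr_ge0; [exact: ltW | exact: expR_ge0].
Qed.

(* Substituting x = exp(s/T) with s <= 0 turns the objective into the value
   at [a] of the tangent line at [s]. *)
Lemma smoothed_ramp_ub a x : 0 <= x <= 1 ->
  a * x - T * (x * ln x - x) <= smoothed_ramp a.
Proof.
move=> /andP[]; rewrite le_eqVlt => /predU1P[<- _|x0 x1].
  by rewrite mul0r mulr0 subr0 mulr0 subr0 smoothed_ramp_ge0.
have s0 : T * ln x <= 0 by rewrite pmulr_rle0 // ln_le0.
have := smoothed_ramp_tangent (T * ln x) a.
rewrite /smoothed_ramp ramp_slopeE // max_r // [T * ln x / T]mulrAC.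
rewrite divff ?gt_eqF // mul1r lnK ?posrE //; apply: le_trans.
by rewrite le_eqVlt; apply/orP; left; apply/eqP; ring.
Qed.

Lemma smoothed_ramp_max a (x := ramp_slope a) :
  a * x - T * (x * ln x - x) = smoothed_ramp a.
Proof.
rewrite /smoothed_ramp /x {3}/ramp_slope expRK.
have [a0|a0] := lerP a 0; first by field; rewrite gt_eqF.
rewrite /ramp_slope (min_r (ltW a0)) mul0r expR0; ring.
Qed.

Lemma ramp_slope_continuous : continuous ramp_slope.
Proof.
move=> a.
apply: (@continuous_comp R R R (fun x => Num.min x 0 / T) expR); last first.
  exact: continuous_expR.
apply: cvgM; last exact: cvg_cst.
by apply: (@continuous_min R R id (cst 0)); [exact: cvg_id | exact: cvg_cst].
Qed.

(* The difference quotient lies between the slopes at both ends. *)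
Lemma smoothed_ramp_derivable a : derivable smoothed_ramp a 1.
Proof.
apply/cvg_ex; exists (ramp_slope a).
pose d h := `|ramp_slope (h + a) - ramp_slope a|.
have d0 : d h @[h --> 0^'] --> (0 : R).
  apply/norm_cvg0P; rewrite -[X in _ --> X](subrr (ramp_slope a)).
  apply: cvgB; last exact: cvg_cst.
  apply: cvg_within_filter => /=.
  have : (fun h => h + a) @ nbhs (0:R) --> a.
    rewrite -[X in _ --> X]add0r.
    by apply: cvgD; [exact: cvg_id | exact: cvg_cst].
  by apply: continuous_cvg; exact: ramp_slope_continuous.
apply: (@squeeze_cvgr _ _ _ _ (fun h => ramp_slope a - d h)
  (fun h => ramp_slope a + d h)); last 2 first.
- by rewrite -[X in _ --> X]subr0; apply: cvgB => //; exact: cvg_cst.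
- by rewrite -[X in _ --> X]addr0; apply: cvgD => //; exact: cvg_cst.
near=> h; rewrite -ler_distl /=.
have h0 : h != 0 by near: h; exact: nbhs_dnbhs_neq.
rewrite [h *: 1]mulr1; set N := smoothed_ramp _ - _.
have t1 := smoothed_ramp_tangent a (h + a).
have t2 := smoothed_ramp_tangent (h + a) a.
have -> : h^-1 *: N - ramp_slope a = h^-1 * (N - ramp_slope a * h).
  by rewrite /GRing.scale /=; field.
rewrite normrM normfV ler_pdivrMl ?normr_gt0 // /d -normrM ger0_norm.
  apply: le_trans (ler_norm _); rewrite /N; nra.
by rewrite /N; nra.
Unshelve. all: by end_near. Qed.

End SmoothedRamp.
(** * The dual function *)

Section SmoothedDual.
Variables (R : realType) (n m : nat) (K : 'I_m -> {set 'I_n}).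
Variables (c : 'rV[R]_(n + m)) (T : R).
Hypothesis c_slack : forall j : 'I_m, c 0 (rshift n j) = 0.
Hypothesis T_gt0 : 0 < T.

Implicit Types lam mu : 'rV[R]_m.

Local Notation rc := (reduced_cost K c).
Local Notation D := (smoothed_dual K c T).

Lemma rshift_ext_clique j k : (rshift n k \in ext_clique K j) = (k == j).
Proof.
rewrite !inE eq_rshift; case: eqVneq => //= _.
by apply/negbTE/imsetP => -[i _ /eqP]; rewrite eq_rlshift.
Qed.

Lemma in_cliques_of i j : (j \in cliques_of K i) = (i \in ext_clique K j).
Proof. by rewrite inE. Qed.

(** The slack index of [j] lies in no other clique. This makes [lam] recoverable from its reduced
    costs and puts a term in [- lam 0 j] into the potential. *)
Lemma reduced_cost_slack lam j : rc lam 0 (rshift n j) = - lam 0 j.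
Proof.
rewrite mxE c_slack sub0r; congr (- _); rewrite (big_pred1 j) // => k /=.
by rewrite in_cliques_of rshift_ext_clique eq_sym.
Qed.

Lemma reduced_cost_inj : injective rc.
Proof.
move=> p q pq; apply/rowP => j; apply: oppr_inj.
by rewrite -!reduced_cost_slack pq.
Qed.

(** Summation by transposing the clique incidence matrix: it turns slopes in the reduced costs into
    a gradient in [lam]. *)
Lemma sum_reduced_costB (w : 'I_(n + m) -> R) lam mu :
  \sum_i w i * (rc mu 0 i - rc lam 0 i) =
  - \sum_j (mu 0 j - lam 0 j) * \sum_(i in ext_clique K j) w i.
Proof.
transitivity (- \sum_i \sum_(j in cliques_of K i) (mu 0 j - lam 0 j) * w i).
  rewrite -sumrN; apply: eq_bigr => i _; rewrite !mxE -mulr_suml sumrB.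
  ring.
congr (- _); rewrite (exchange_big_dep predT) //=.
apply: eq_bigr => j _; rewrite mulr_sumr; apply: eq_bigl => i.
by rewrite in_cliques_of.
Qed.

Lemma smoothed_dualE lam :
  D lam = \sum_j lam 0 j + \sum_i smoothed_ramp T (rc lam 0 i).
Proof.
have objE x : smoothed_objective K c T lam x =
    \sum_i (rc lam 0 i * x 0 i - T * (x 0 i * ln (x 0 i) - x 0 i)).
  by rewrite sumrB -mulr_sumr -mulrN.
have [x xcube [xmax ->]] := smoothed_dual_max K c lam T_gt0.
congr (_ + _); apply/eqP; rewrite eq_le; apply/andP; split.
  by rewrite objE; apply: ler_sum => i _; exact: smoothed_ramp_ub.
pose y : 'rV[R]_(n + m) := \row_i ramp_slope T (rc lam 0 i).
apply: le_trans (xmax y _); last by move=> i; rewrite mxE; exact: ramp_slope01.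
rewrite objE; apply: ler_sum => i _.
by rewrite [y 0 i]mxE -smoothed_ramp_max.
Qed.

(** The j-th partial derivative of [D], used below only as a subgradient. *)
Definition dual_grad lam j : R :=
  1 - \sum_(i in ext_clique K j) ramp_slope T (rc lam 0 i).

Lemma smoothed_dual_tangent lam mu :
  D lam + \sum_j (mu 0 j - lam 0 j) * dual_grad lam j <= D mu.
Proof.
have gradE : \sum_j (mu 0 j - lam 0 j) * dual_grad lam j =
    \sum_j mu 0 j - \sum_j lam 0 j +
    \sum_i ramp_slope T (rc lam 0 i) * (rc mu 0 i - rc lam 0 i).
  rewrite sum_reduced_costB -!sumrB; apply: eq_bigr => j _.
  by rewrite /dual_grad mulrBr mulr1.
have : \sum_i (smoothed_ramp T (rc lam 0 i) +
               ramp_slope T (rc lam 0 i) * (rc mu 0 i - rc lam 0 i)) <=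
       \sum_i smoothed_ramp T (rc mu 0 i).
  by apply: ler_sum => i _; exact: smoothed_ramp_tangent.
by rewrite !smoothed_dualE gradE big_split /=; lra.
Qed.

(** Average the tangent inequalities based at the convex combination [z], evaluated at [x] and [y]:
    the linear terms cancel. *)
Lemma smoothed_dual_convex : convex_function setT D.
Proof.
have aux (s dz dx dy gx gy : R) : 0 <= s -> 0 <= 1 - s ->
    dz + gx <= dx -> dz + gy <= dy -> s * gx + (1 - s) * gy = 0 ->
    dz <= s * dx + (1 - s) * dy by nra.
move=> t x y _ _; rewrite convRE.
set z : 'rV[R]_m := (X in D X <= _).
have zE : z = t%:num *: x + (1 - t%:num) *: y by [].
have tx := smoothed_dual_tangent z x; have ty := smoothed_dual_tangent z y.
have t0 : 0 <= t%:num by [].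
have t1 : 0 <= 1 - t%:num by rewrite subr_ge0.
have e : t%:num * (\sum_j (x 0 j - z 0 j) * dual_grad z j) +
         (1 - t%:num) * (\sum_j (y 0 j - z 0 j) * dual_grad z j) = 0.
  rewrite !mulr_sumr -big_split big1 // => j _ /=.
  have -> : z 0 j = t%:num * x 0 j + (1 - t%:num) * y 0 j by rewrite zE !mxE.
  by ring.
exact: aux t0 t1 tx ty e.
Qed.

Lemma reduced_cost_differentiable i lam :
  differentiable (fun l => rc l 0 i) lam.
Proof.
have -> : (fun l => rc l 0 i) = cst (c 0 i) -
    \sum_(j < m) (fun l : 'rV[R]_m => l 0 j *+ (j \in cliques_of K i)).
  apply/funext => l; rewrite mxE !fctE fct_sumE; congr (_ - _).
  by rewrite big_mkcond; apply: eq_bigr => j _; case: ifP.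
apply: differentiableB; first exact: differentiable_cst.
apply: differentiable_sum => j; case: (_ \in _).
  exact: differentiable_coord.
exact: differentiable_cst.
Qed.

Lemma smoothed_dual_differentiable lam : differentiable D lam.
Proof.
have -> : D = \sum_(j < m) (fun l : 'rV[R]_m => l 0 j) +
    \sum_(i < n + m) (smoothed_ramp T \o (fun l => rc l 0 i)).
  by apply/funext => l; rewrite smoothed_dualE fctE !fct_sumE.
apply: differentiableD; apply: differentiable_sum => i.
  exact: differentiable_coord.
apply: differentiable_comp; last first.
  by apply/derivable1_diffP; exact: smoothed_ramp_derivable.
exact: reduced_cost_differentiable.
Qed.

Lemma set_coordE lam j v :
  set_coord lam j v = lam + (v - lam 0 j) *: delta_mx 0 j.
Proof.
apply/rowP => k; rewrite !mxE eqxx /=; case: eqVneq => [->|_].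
  by rewrite mulr1 subrKC.
by rewrite mulr0 addr0.
Qed.

Lemma smoothed_dual_coord_min lam j v : dual_grad lam j = 0 ->
  D lam <= D (lam + v *: delta_mx 0 j).
Proof.
move=> g0; have := smoothed_dual_tangent lam (lam + v *: delta_mx 0 j).
rewrite big1 ?addr0 // => k _; rewrite !mxE eqxx /=.
case: eqVneq => [->|_]; first by rewrite g0 mulr0.
by rewrite mulr0 addr0 subrr mul0r.
Qed.

(** By the tangent inequality 0 minimizes [D] along the coordinate line through [lam], so Fermat's
    rule on (-1, 1) applies. *)
Lemma smoothed_dual_is_derive lam j : dual_grad lam j = 0 ->
  is_derive lam (delta_mx 0 j : 'rV[R]_m) D 0.
Proof.
move=> g0; set v := delta_mx 0 j.
have dD : derivable D lam v.
  exact/diff_derivable/smoothed_dual_differentiable.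
apply: DeriveDef => //.
pose g (h : R) := D (h *: v + lam).
have dg x : derivable g x 1.
  apply/derivable1_diffP.
  apply: (@differentiable_comp _ _ _ _ (fun h : R => h *: v + lam)).
    by apply: differentiableD.
  exact: smoothed_dual_differentiable.
have : is_derive (0 : R) 1 g 0.
  apply: (@derive1_at_min R g (-1) 1).
  - by lra.
  - by move=> t _; exact: dg.
  - by rewrite in_itv /= ltrN10 ltr01.
  - by move=> t _; rewrite /g scale0r add0r addrC smoothed_dual_coord_min.
case=> _ <-; rewrite /derive.
suff -> : (fun h => h^-1 *: ((D \o shift lam) (h *: v) - D lam)) =
          (fun h => h^-1 *: ((g \o shift 0) (h *: 1) - g 0)) by [].
by apply/funext => h /=; rewrite /g scale0r add0r [h *: 1]mulr1 addr0.
Qed.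

(** * Coordinate steps and the exponential potential *)

Definition clique_mass lam j : R :=
  \sum_(i in ext_clique K j) expR (rc lam 0 i / T).

(* The dual function with the box [0, 1] relaxed to x >= 0; every step
   decreases it, even while some reduced costs are still positive. *)
Definition potential lam : R :=
  \sum_j lam 0 j + T * \sum_i expR (rc lam 0 i / T).

Lemma clique_mass_gt0 lam j : 0 < clique_mass lam j.
Proof.
rewrite /clique_mass (bigD1 (rshift n j)) ?rshift_ext_clique //=.
by rewrite ltr_pwDl ?expR_gt0 // sumr_ge0 // => i _; exact: expR_ge0.
Qed.

(** Log-sum-exp commutes with shifts, so the maximal reduced cost cancels and the choice of the
    maximizer is immaterial. *)
Lemma bregman_stepE j lam lam' : bregman_step K c T j lam lam' ->
  lam' = lam + (T * ln (clique_mass lam j)) *: delta_mx 0 j.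
Proof.
move=> [i [_ _ ->]]; rewrite set_coordE; congr (_ + _ *: _).
rewrite -[X in X - _]addrA [lam 0 j + _]addrC addrK.
have -> : \sum_(k in ext_clique K j) expR ((rc lam 0 k - rc lam 0 i) / T) =
    clique_mass lam j / expR (rc lam 0 i / T).
  rewrite mulr_suml; apply: eq_bigr => k _.
  by rewrite -expRN -expRD mulrBl.
rewrite ln_div ?posrE ?clique_mass_gt0 ?expR_gt0 // expRK.
by field; rewrite gt_eqF.
Qed.

Lemma reduced_cost_shift lam j v i :
  rc (lam + v *: delta_mx 0 j) 0 i = rc lam 0 i - v *+ (i \in ext_clique K j).
Proof.
rewrite !mxE -addrA -opprD; congr (_ - _).
under eq_bigr do rewrite !mxE eqxx /=.
rewrite big_split /=; congr (_ + _).
have [ij|ij] := boolP (i \in _).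
  rewrite (bigD1 j) ?in_cliques_of //= eqxx mulr1 big1 ?addr0 //.
  by move=> k /andP[_ /negbTE->]; rewrite mulr0.
rewrite big1 // => k; rewrite in_cliques_of => ik.
case: eqVneq => [kj|_]; last by rewrite mulr0.
by rewrite kj (negbTE ij) in ik.
Qed.

Lemma clique_mass_step lam j :
  clique_mass (lam + (T * ln (clique_mass lam j)) *: delta_mx 0 j) j = 1.
Proof.
have S0 := clique_mass_gt0 lam j.
rewrite {1}/clique_mass; set s := ln _.
transitivity (clique_mass lam j / expR s); last by rewrite lnK // divff ?gt_eqF.
rewrite mulr_suml; apply: eq_bigr => i ij; rewrite reduced_cost_shift ij mulr1n.
rewrite -expRN -expRD; congr expR; by field; rewrite gt_eqF.
Qed.

(** The linear part grows by [T * ln S], the clique's exponential part falls from [T * S] to [T],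
    and the other terms stay. *)
Lemma potential_step lam j (S := clique_mass lam j) :
  potential lam - potential (lam + (T * ln S) *: delta_mx 0 j) =
  T * (S - 1 - ln S).
Proof.
set lam' := lam + _.
have sumE : \sum_k lam' 0 k = \sum_k lam 0 k + T * ln S.
  under eq_bigr do rewrite !mxE eqxx /=.
  rewrite big_split; congr (_ + _).
  rewrite (bigD1 j) //= eqxx mulr1 big1 ?addr0 // => k /negbTE->.
  by rewrite mulr0.
have splitE mu : \sum_i expR (rc mu 0 i / T) = clique_mass mu j +
    \sum_(i | i \notin ext_clique K j) expR (rc mu 0 i / T).
  by rewrite (bigID (mem (ext_clique K j))).
rewrite /potential sumE !splitE clique_mass_step.
have -> : \sum_(i | i \notin ext_clique K j) expR (rc lam' 0 i / T) =
          \sum_(i | i \notin ext_clique K j) expR (rc lam 0 i / T).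
  apply: eq_bigr => i /negbTE ij.
  by rewrite reduced_cost_shift ij mulr0n subr0.
by rewrite -/S; ring.
Qed.

(** * Points of unit clique mass: optimality and uniqueness *)

Lemma clique_mass1_le1 lam j i : clique_mass lam j = 1 ->
  i \in ext_clique K j -> expR (rc lam 0 i / T) <= 1.
Proof.
by move=> <- ij; rewrite /clique_mass (bigD1 i) //= lerDl sumr_ge0.
Qed.

Lemma clique_mass1_le0 lam j i : clique_mass lam j = 1 ->
  i \in ext_clique K j -> rc lam 0 i <= 0.
Proof.
move=> S1 /(clique_mass1_le1 S1); rewrite -[leRHS]expR0 ler_expR.
by rewrite pmulr_lle0 // invr_gt0.
Qed.

Lemma clique_mass1_dual_grad lam j :
  clique_mass lam j = 1 -> dual_grad lam j = 0.
Proof.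
move=> S1; apply/eqP; rewrite subr_eq0 -S1; apply/eqP; apply: eq_bigr => i ij.
by rewrite ramp_slopeE // (clique_mass1_le0 S1 ij).
Qed.

Lemma clique_mass1_min lam : (forall j, clique_mass lam j = 1) ->
  forall mu, D lam <= D mu.
Proof.
move=> S1 mu; have := smoothed_dual_tangent lam mu.
by rewrite big1 ?addr0 // => j _; rewrite clique_mass1_dual_grad ?mulr0.
Qed.

(* Strict monotonicity of exp makes the gradient of the potential strictly
   monotone, because the reduced costs determine lam. *)
Lemma clique_mass1_unique lam mu : (forall j, clique_mass lam j = 1) ->
  (forall j, clique_mass mu j = 1) -> lam = mu.
Proof.
move=> Sl Sm; apply: reduced_cost_inj.
pose a i := expR (rc mu 0 i / T) - expR (rc lam 0 i / T).
have sum0 : \sum_i a i * (rc mu 0 i - rc lam 0 i) = 0.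
  rewrite sum_reduced_costB big1 ?oppr0 // => j _.
  by rewrite sumrB -!/(clique_mass _ _) Sl Sm subrr mulr0.
have a_ge0 i : 0 <= a i * (rc mu 0 i - rc lam 0 i).
  have [le|lt] := lerP (rc lam 0 i) (rc mu 0 i).
    by rewrite mulr_ge0 ?subr_ge0 // ler_expR ler_pM2r ?invr_gt0.
  by rewrite mulr_le0 ?subr_le0 ?ler_expR ?ler_pM2r ?invr_gt0 // ltW.
apply/rowP => i; apply/eqP.
move/eqP: sum0; rewrite psumr_eq0 // => /allP /(_ i); rewrite mem_index_enum.
move=> /(_ isT) /=; rewrite mulf_eq0 !subr_eq0 => /orP[|/eqP->] //.
by move=> /eqP /expR_inj /divIf -> //; rewrite gt_eqF.
Qed.

(** Keeping only slack exponentials bounds the potential below by the sum of the [f k], each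
    nonnegative by the tangent of exp at 0. If [lam 0 j <= 0], then [expR x >= 2 * x] at
    [x = - lam 0 j / T] gives [f j >= - lam 0 j]. *)
Lemma potential_bound lam j : `|lam 0 j| <= potential lam.
Proof.
pose f k := lam 0 k + T * expR (- lam 0 k / T).
have f0 k : 0 <= f k.
  have := expR_tangent T_gt0 0 (- lam 0 k).
  rewrite mul0r expR0 mulr1 mul1r subr0 lerBlDl.
  by apply: le_trans; exact: ltW.
have fj : f j <= potential lam.
  apply: (@le_trans _ _ (\sum_k f k)).
    by rewrite (bigD1 j) //= lerDl sumr_ge0.
  rewrite /potential big_split_ord /= mulrDr addrCA.
  rewrite big_split /= -mulr_sumr.
  under [X in _ <= _ + (_ + T * X)]eq_bigr do rewrite reduced_cost_slack.
  by rewrite lerDr mulr_ge0 ?sumr_ge0 ?(ltW T_gt0) // => i _; exact: expR_ge0.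
apply: le_trans fj; rewrite /f; have e0 := expR_ge0 (- lam 0 j / T).
have [l0|l0] := ler0P (lam 0 j); last by rewrite lerDl mulr_ge0 // ltW.
have := @expR_ge2x R (- lam 0 j / T).
rewrite divr_ge0 ?oppr_ge0 ?(ltW T_gt0) // => /(_ isT).
rewrite -(ler_pM2l T_gt0).
have -> : T * (2 * (- lam 0 j / T)) = - lam 0 j - lam 0 j.
  by field; rewrite gt_eqF.
by rewrite lerBlDl.
Qed.

(** * Convergence of a run *)

Lemma clique_mass_continuous j : continuous (clique_mass ^~ j).
Proof.
move=> lam; apply: (@cvg_bigsum _ _ _ (nbhs lam)) => i _.
apply: (@continuous_comp 'rV[R]_m R R (fun l => rc l 0 i / T) expR); last first.
  exact: continuous_expR.
apply: (@cvgM _ _ (nbhs lam)); last exact: cvg_cst.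
exact/differentiable_continuous/reduced_cost_differentiable.
Qed.

Variables (lam0 : 'rV[R]_m) (lam : nat -> nat -> 'rV[R]_m).
Hypothesis lam_run : bregman_run K c T lam0 lam.

Lemma run_step t (j : 'I_m) : lam t j.+1 =
  lam t j + (T * ln (clique_mass (lam t j) j)) *: delta_mx 0 j.
Proof. by case: lam_run => _ + _ => /(_ t j) /bregman_stepE. Qed.

Lemma run_clique_mass t (j : 'I_m) : clique_mass (lam t j.+1) j = 1.
Proof. by rewrite run_step clique_mass_step. Qed.

Lemma run_decrease t (j : 'I_m) (d := ln (clique_mass (lam t j) j)) :
  T * (expR (d / 2) - 1) ^+ 2 <=
  potential (lam t j) - potential (lam t j.+1).
Proof.
rewrite run_step potential_step ler_pM2l //.
apply: le_trans (sqr_expR_half_le d) _.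
by rewrite /d lnK ?posrE ?clique_mass_gt0.
Qed.

Lemma run_potential_le t k k' : (k <= k' <= m)%N ->
  potential (lam t k') <= potential (lam t k).
Proof.
move=> /andP[]; elim: k' => [|k' IH]; first by rewrite leqn0 => /eqP->.
rewrite leq_eqVlt => /predU1P[-> //|kk' k'm].
apply: le_trans (IH kk' (ltnW k'm)); rewrite -subr_ge0.
apply: le_trans (run_decrease t (Ordinal k'm)).
by rewrite mulr_ge0 ?sqr_ge0 // ltW.
Qed.

Lemma run_potential_nonincreasing :
  nonincreasing_seq (fun t => potential (lam t 0)).
Proof.
apply/nonincreasing_seqP => t.
by case: lam_run => _ _ ->; apply: run_potential_le; rewrite leq0n leqnn.
Qed.

Lemma run_bounded t j : `|lam t 0 0 j| <= potential lam0.
Proof.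
apply: le_trans (potential_bound _ _) _; case: lam_run => <- _ _.
exact: run_potential_nonincreasing.
Qed.

(** The potential at the start of outer iterations is nonincreasing and nonnegative, so its
    decrements tend to 0. *)
Lemma run_step_cvg0 (j : 'I_m) :
  (fun t => T * ln (clique_mass (lam t j) j)) @ \oo --> (0 : R).
Proof.
pose p t := potential (lam t 0).
pose d t := ln (clique_mass (lam t j) j).
have pcvg : cvgn p.
  apply: nonincreasing_is_cvgn; first exact: run_potential_nonincreasing.
  exists 0 => _ [t _ <-]; exact: le_trans (normr_ge0 _) (potential_bound _ j).
have p0 : (fun t => (p t - p t.+1) / T) @ \oo --> (0 : R).
  rewrite -[X in _ --> X](mul0r T^-1); apply: cvgM; last exact: cvg_cst.
  rewrite -[X in _ --> X](subrr (limn p)); apply: cvgB => //.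
  by rewrite -(cvg_shiftS p) in pcvg *.
have e0 : (fun t => expR (d t / 2) - 1) @ \oo --> (0 : R).
  apply: cvg_sqr0; apply: (squeeze_cvgr _ (cvg_cst 0) p0).
  near=> t; rewrite sqr_ge0 ler_pdivlMr // mulrC.
  (* The decrease at step [j] is at most that of the whole outer iteration. *)
  apply: le_trans (run_decrease t j) _; apply: lerB.
    by apply: run_potential_le; rewrite leq0n ltnW.
  rewrite /p; case: lam_run => _ _ ->; apply: run_potential_le.
  by rewrite ltn_ord leqnn.
have e1 : (fun t => expR (d t / 2)) @ \oo --> (1 : R).
  by apply: cvg_sub0 e0 (cvg_cst _).
have l0 : (fun t => ln (expR (d t / 2))) @ \oo --> (0 : R).
  rewrite -[X in _ --> X](@ln1 R).
  by apply: continuous_cvg e1; exact: continuous_ln.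
rewrite -[X in _ --> X](mulr0 T); apply: cvgM; first exact: cvg_cst.
rewrite (_ : (fun t => _) = (fun t => ln (expR (d t / 2)) * 2)); last first.
  by apply/funext => t; rewrite expRK divfK.
by rewrite -[X in _ --> X](mul0r 2); apply: cvgM => //; exact: cvg_cst.
Unshelve. all: by end_near. Qed.

Lemma run_gap_cvg0 k : (k <= m)%N ->
  (fun t => lam t k - lam t 0) @ \oo --> (0 : 'rV[R]_m).
Proof.
elim: k => [_|k IH km].
  have -> : (fun t => lam t 0 - lam t 0) = cst 0.
    by apply/funext => t; rewrite subrr.
  exact: cvg_cst.
pose v : 'rV[R]_m := delta_mx 0 (Ordinal km).
have z0 : (fun t => (T * ln (clique_mass (lam t k) (Ordinal km))) *: v) @ \oo
    --> 0 *: v.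
  by apply: cvgZ; [exact: (run_step_cvg0 (Ordinal km)) | exact: cvg_cst].
have -> : (fun t => lam t k.+1 - lam t 0) = (fun t => lam t k - lam t 0) +
    (fun t => (T * ln (clique_mass (lam t k) (Ordinal km))) *: v).
  by apply/funext => t; rewrite (run_step _ (Ordinal km)) addrAC.
rewrite scale0r in z0; rewrite -[X in _ --> X](addr0 (0 : 'rV[R]_m)).
exact: cvgD (IH (ltnW km)) z0.
Qed.

(** The mass is exactly 1 at [lam t j.+1], whose distance to [lam t 0] vanishes. The error is
    controlled by the relative errors [r i t], since each exponential at [lam t j.+1] is at most
    1. *)
Lemma run_clique_mass_cvg1 (j : 'I_m) :
  (fun t => clique_mass (lam t 0) j) @ \oo --> (1 : R).
Proof.
pose r i t := expR ((rc (lam t 0) 0 i - rc (lam t j.+1) 0 i) / T) - 1.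
(* Reduced costs are affine in [lam], so their difference is a continuous function of the gap
   alone. *)
have rcB lam1 lam2 i : rc lam1 0 i - rc lam2 0 i = c 0 i - rc (lam2 - lam1) 0 i.
  rewrite !mxE; under [X in _ = _ - (_ - X)]eq_bigr do rewrite !mxE.
  rewrite sumrB; ring.
have r0 i : r i @ \oo --> (0 : R).
  rewrite -[X in _ --> X](subrr 1); apply: cvgB; last exact: cvg_cst.
  rewrite -[X in _ --> X](@expR0 R).
  apply: continuous_cvg; first exact: continuous_expR.
  rewrite -[X in _ --> X](mul0r T^-1); apply: cvgM; last exact: cvg_cst.
  under eq_fun do rewrite rcB.
  have -> : 0 = c 0 i - rc 0 0 i.
    by rewrite mxE big1 ?subr0 ?subrr // => k _; rewrite mxE.
  apply: cvgB; first exact: cvg_cst.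
  apply: (@continuous_cvg _ _ _ _ _ _ (fun l => rc l 0 i)); last first.
    exact: run_gap_cvg0.
  exact/differentiable_continuous/reduced_cost_differentiable.
apply: (@cvg_sub0 R R _ _ _ _ (cst 1)); last exact: cvg_cst.
apply/norm_cvg0P.
have s0 : (fun t => \sum_(i in ext_clique K j) `|r i t|) @ \oo --> (0 : R).
  rewrite [X in _ --> X](_ : _ = \sum_(i in ext_clique K j) 0); last first.
    by rewrite big1.
  by apply: (@cvg_bigsum _ _ _ \oo) => i _; apply/norm_cvg0P; exact: r0.
apply: (squeeze_cvgr _ (cvg_cst 0) s0); near=> t.
rewrite normr_ge0 /= fctE -(run_clique_mass t j) -sumrB.
apply: le_trans (ler_norm_sum _ _ _) _; apply: ler_sum => i ij.
set a := rc _ 0 i; set b := rc _ 0 i.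
have -> : expR (a / T) - expR (b / T) = expR (b / T) * r i t.
  by rewrite /r mulrBr mulr1 -expRD -/a -/b -mulrDl subrKC.
rewrite normrM ger0_norm ?expR_ge0 // ler_piMl //.
exact: clique_mass1_le1 (run_clique_mass t j) ij.
Unshelve. all: by end_near. Qed.

Lemma run_cvg : exists2 lamopt, forall j, clique_mass lamopt j = 1 &
  forall k, (k <= m)%N -> (fun t => lam t k) @ \oo --> lamopt.
Proof.
pose F := (fun t => lam t 0) @ \oo.
pose box (B : R) := [set v : 'rV[R]_m | forall i, `[- B, B]%classic (v 0 i)].
have boxc B : compact (box B).
  apply: (@rV_compact _ _ (fun=> `[- B, B]%classic)) => _.
  exact: segment_compact.
have Fbox B : potential lam0 <= B -> F (box B).
  move=> B0; exists 0%N => // t _ i /=.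
  by rewrite in_itv /= -ler_norml; exact: le_trans (run_bounded t i) B0.
(* A cluster point is the limit of a finer filter [G], along which the mass tends both to its value
   at [q] and to 1. *)
have cluster1 q : cluster F q -> forall j, clique_mass q j = 1.
  rewrite cluster_cvgE => -[G PG [Gq FG]] j.
  have c1 : (clique_mass ^~ j) @ G --> clique_mass q j.
    by move=> A qA; apply: Gq; exact: clique_mass_continuous.
  have c2 : (clique_mass ^~ j) @ G --> (1 : R).
    by move=> A A1; apply: FG; exact: (run_clique_mass_cvg1 j A1).
  exact: cvg_unique c1 c2.
have [p [pbox pF]] := boxc (potential lam0) F _ (Fbox _ (lexx _)).
(* A filter containing a compact neighbourhood of its only cluster point converges to it; widening
   the box by 1 makes it a neighbourhood of [p]. *)
have Fp : F --> p.
  apply: (@compact_cluster_set1 _ p F (box (potential lam0 + 1))) => //.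
  - apply/nbhs_ballP; exists 1 => //= q [_ pq] i.
    have := pq 0 i; rewrite /ball /= => pqi.
    have := pbox i; rewrite /= !in_itv /= -!ler_norml => pi.
    have -> : q 0 i = p 0 i - (p 0 i - q 0 i) by ring.
    by apply: le_trans (ler_normB _ _) _; apply: lerD => //; exact: ltW.
  - by apply: Fbox; rewrite lerDl.
  - apply/seteqP; split=> [q qF|_ -> //].
    exact: clique_mass1_unique (cluster1 q qF) (cluster1 p pF).
exists p; first exact: cluster1.
move=> k km; apply: (@cvg_sub0 _ _ _ _ _ _ (fun t => lam t 0)) => //.
exact: run_gap_cvg0.
Qed.

End SmoothedDual.

Theorem proposition5 (R : realType) (n m : nat)
    (e : rel 'I_n) (e_sym : symmetric e) (e_irr : irreflexive e)
    (K : 'I_m -> {set 'I_n}) (K_cover : clique_cover e K)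
    (c : 'rV[R]_(n + m)) (c_slack : forall j : 'I_m, c 0 (rshift n j) = 0)
    (T : R) (T_gt0 : 0 < T) :
  let D : 'rV[R]_m -> R := smoothed_dual K c T in
  [/\ convex_function setT D,
      forall lam : 'rV[R]_m, differentiable D lam
    & forall (lam0 : 'rV[R]_m) (lam : nat -> nat -> 'rV[R]_m),
        bregman_run K c T lam0 lam ->
        [/\ exists2 lamopt : 'rV[R]_m,
              forall mu : 'rV[R]_m, D lamopt <= D mu
              & forall k : nat, (k <= m)%N ->
                  (fun t : nat => lam t k) @ \oo --> lamopt,
            forall (t : nat) (j : 'I_m) (v : R),
              D (lam t j.+1) <= D (set_coord (lam t j) j v)
          & forall (t : nat) (j : 'I_m),
              is_derive (lam t j.+1) (delta_mx 0 j : 'rV[R]_m) D 0]].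
Proof.
move=> D; split=> [|lam|lam0 lam run].
- exact: smoothed_dual_convex.
- exact: smoothed_dual_differentiable.
have grad0 t j : dual_grad K c T (lam t (j : 'I_m).+1) j = 0.
  exact/clique_mass1_dual_grad/(run_clique_mass T_gt0 run).
split=> [|t j v|t j].
- have [lamopt mass1 cvg_lam] := run_cvg c_slack T_gt0 run.
  by exists lamopt => //; exact: clique_mass1_min.
(* The step changes coordinate [j] only, so overwriting that coordinate before or after it gives the
   same vector. *)
- have -> : set_coord (lam t j) j v =
      lam t j.+1 + (v - lam t j.+1 0 j) *: delta_mx 0 j.
    rewrite -set_coordE (run_step T_gt0 run); apply/rowP => k; rewrite !mxE.
    by case: eqVneq => // _; rewrite andbF mulr0 addr0.
  exact: smoothed_dual_coord_min.
- exact: smoothed_dual_is_derive.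
Qed.
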